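(* Let $X$ be a random variable with probability mass function $$f(k)=(1-\rho(k))\prod_{t=1}^{k-1}\rho(t),\qquad k=1,2,3,\ldots,$$ and suppose that $\lim_{k\to\infty}\rho(k)=r$, where necessarily $r\in[0,1]$ because $\rho(k)\in[0,1]$. Then all moments of $X$ exist whenever $r<1$. If $r=1$, then some moments may exist.
   Context: Here $(\rho(k))_{k\ge1}$ is a sequence with values in $(0,1]$ (the case of infinite support, $T=\infty$), the empty product equals $1$, and $f$ is assumed to be a probability mass function on $\{1,2,3,\ldots\}$. That all moments exist means $\mathrm{E}(X^n)<\infty$ for every integer $n\ge1$. The final sentence, for $r=1$, is an inconclusive remark: moments may or may not exist in that case. *)

(* Defs.v *)
From HB Require Import structures.
From mathcomp Require Import all_boot all_order all_algebra.
From mathcomp Require Import all_classical all_reals all_analysis.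
Set Implicit Arguments.
Unset Strict Implicit.
Unset Printing Implicit Defensive.
Import Order.TTheory GRing.Theory Num.Theory.
Import numFieldNormedType.Exports.

Local Open Scope classical_set_scope.
Local Open Scope ring_scope.

(* Sequences indexed by k >= 1 are functions on nat whose value at 0 is never
   used. *)

Definition ratio_pmf (R : realType) (rho : nat -> R) (k : nat) : R :=
  (1 - rho k) * \prod_(1 <= t < k) rho t.

Definition is_pmf (R : realType) (f : nat -> R) : Prop :=
  (forall k, (1 <= k)%N -> 0 <= f k) /\
  (\sum_(1 <= k <oo) (f k)%:E = 1)%E.

(* When f is a probability mass function on the positive integers, this forces
   X to take its values in the positive integers almost surely. *)
Definition has_pmf (R : realType) (d : measure_display) (T : measurableType d)
    (P : probability T R) (X : {RV P >-> R}) (f : nat -> R) : Prop :=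
  forall k, (1 <= k)%N -> pmf X k%:R = f k.

Definition has_ratio_pmf (R : realType) (d : measure_display)
    (T : measurableType d) (P : probability T R) (X : {RV P >-> R})
    (rho : nat -> R) : Prop :=
  [/\ forall k, (1 <= k)%N -> 0 < rho k <= 1,
      is_pmf (ratio_pmf rho)
    & has_pmf X (ratio_pmf rho)].

(* For the X above, X ^+ n is nonnegative almost surely, so its expectation in
   \bar R is the usual one, possibly +oo. *)
Definition moment_exists (R : realType) (d : measure_display)
    (T : measurableType d) (P : probability T R) (X : {RV P >-> R})
    (n : nat) : Prop :=
  ('E_P[fun w => (X w ^+ n)%R] < +oo)%E.

(* Main.v *)
Require Import Defs.
From HB Require Import structures.
From mathcomp Require Import all_boot all_order all_algebra.
From mathcomp Require Import all_classical all_reals all_analysis.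
From mathcomp Require Import measurable_realfun ring.
Import Order.TTheory GRing.Theory Num.Theory.
Import numFieldNormedType.Exports.

Local Open Scope classical_set_scope.
Local Open Scope ring_scope.

(* Write S k for the product of the rho t with t < k, so that
   f k = S k - S (k+1) <= S k and E(X^n) is the sum of the k^n f k. The ratio of
   consecutive terms of k^n S k is ((k+1)/k)^n rho k, which tends to r, so for
   r < 1 the ratio test applies. For r = 1, take S k = k^-m, that is
   rho k = (k/(k+1))^m: the moment of order n is finite for m = n + 2, and
   infinite for m = 1, as it dominates the harmonic series. *)

(** * Moments as series over the mass function *)

Lemma eseries_recl (R : realType) (f : nat -> \bar R) :
  (forall k, (1 <= k)%N -> 0 <= f k)%E ->
  (\sum_(1 <= k <oo) f k = \sum_(0 <= k <oo) f k.+1)%E.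
Proof.
(* [f 0] is unconstrained, so it is replaced by 0 before the shift, which needs nonnegative terms
   throughout. *)
move=> f0; pose g k := if k is 0 then 0%E else f k.
have g0 k : (0 <= g k)%E by case: k => //= k; exact: f0.
transitivity (\sum_(1 <= k <oo) g k)%E.
  apply: congr_lim; apply/funext => n; apply: eq_big_nat => -[|k]//.
by rewrite -nneseries_addn//; apply: eq_eseriesr => k _; rewrite addn1.
Qed.

Section expectation.
Variables (R : realType) (d : measure_display) (T : measurableType d).
Variables (P : probability T R) (X : {RV P >-> R}) (f : nat -> R).
Hypotheses (f_pmf : is_pmf f) (X_pmf : has_pmf X f).

Let F k := X @^-1` [set k.+1%:R].

Let mF k : measurable (F k).
Proof. by rewrite /F -[_ @^-1` _]setTI; exact: measurable_funP. Qed.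

Let PF k : P (F k) = (f k.+1)%:E.
Proof. by rewrite -X_pmf// /pmf fineK// fin_num_measure. Qed.

Let tF : trivIset setT F.
Proof.
apply/trivIsetP => i j _ _ ij; rewrite -subset0 => t []; rewrite /F/= => -> /eqP.
by rewrite eqr_nat eqSS (negbTE ij).
Qed.

Let mUF : measurable (\bigcup_k F k).
Proof. exact: bigcup_measurable. Qed.

Let PUF : P (\bigcup_k F k) = 1%E.
Proof.
rewrite measure_semi_bigcup//.
rewrite -(proj2 f_pmf) eseries_recl; last first.
  by move=> k k1; rewrite lee_fin; exact: (proj1 f_pmf).
by apply: eq_eseriesr => k _; exact: PF.
Qed.

(** The events [F k] carry total mass 1, so the integral may be restricted to their disjoint union,
    and [X ^+ n] is constant on each of them. *)
Lemma expectation_exprn_pmf (n : nat) :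
  ('E_P[fun w => (X w ^+ n)%R] =
   \sum_(1 <= k <oo) (k%:R ^+ n * f k)%:E)%E.
Proof.
pose D := \bigcup_k F k; pose g w : \bar R := (X w ^+ n)%:E.
have mg : measurable_fun setT g.
  by apply/measurable_EFinP; exact: measurable_funX.
have PCUF : P (~` D) = 0%E by rewrite probability_setC// PUF subee.
transitivity (\int[P]_(w in D) g w)%E.
  rewrite unlock [RHS]integral_mkcond; apply: ae_eq_integral => //.
  - by apply/(measurable_restrictT _ mUF); exact: measurable_funS mg.
  - exists (~` D); split; first exact: measurableC.
      exact: PCUF.
    by move=> w /= + Dw; apply => _; rewrite patchE mem_set.
(* Countable additivity is applied only after the restriction to [D]: elsewhere [X] may be
   negative. *)
rewrite ge0_integral_bigcup//; last 2 first.
- exact: measurable_funS mg.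
- by move=> w [k _]; rewrite /F/= /g lee_fin => ->; rewrite exprn_ge0.
rewrite eseries_recl; last first.
  by move=> k k1; rewrite lee_fin mulr_ge0 ?exprn_ge0//; exact: (proj1 f_pmf).
apply: eq_eseriesr => k _.
rewrite (eq_integral (cst (k.+1%:R ^+ n)%:E)); last first.
  by move=> w; rewrite inE /F /g/= => ->.
by rewrite integral_cst// EFinM; congr (_ * _)%E; exact: PF.
Qed.

End expectation.

(** * Existence of a variable with a given mass function *)

(** The space is [nat] with the sum of the Dirac masses at [k] weighted by [f k], and [X] is the
    embedding of [nat] into [R]. *)
Lemma pmf_realization (R : realType) (f : nat -> R) : is_pmf f ->
  exists (d : measure_display) (T : measurableType d) (P : probability T R)
    (X : {RV P >-> R}), has_pmf X f.
Proof.
move=> [f0 f1].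
have nf k : 0 <= Num.max (f k) 0 by rewrite le_max lexx orbT.
(* The maximum only matters at [k = 0], where [f] may be negative. *)
pose m (k : nat) : {measure set nat -> \bar R} :=
  mscale (NngNum (nf k)) (\d_k).
have mE k A : (1 <= k)%N -> m k A = ((f k) * (k \in A)%:R)%:E.
  by move=> k1; rewrite /m /= /mscale/= /dirac indicE -EFinM max_l ?f0.
have mseriesE A : mseries m 1 A = (\sum_(1 <= k <oo) (f k * (k \in A)%:R)%:E)%E.
  apply: congr_lim; apply/funext => N; apply: eq_big_nat => k /andP[k1 _].
  exact: mE.
have P1 : mseries m 1 setT = 1%E.
  rewrite mseriesE -f1; apply: congr_lim; apply/funext => N.
  by apply: eq_big_nat => k /andP[k1 _]; rewrite in_setT mulr1.
pose b := Measure_isProbability.Build _ _ _ (mseries m 1) P1.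
pose P : probability nat R := HB.pack (mseries m 1) b.
pose X (k : nat) : R := k%:R.
have mX : measurable_fun [set: nat] X by [].
pose bX := isMeasurableFun.Build _ _ _ _ X mX.
pose X' : {RV P >-> R} := HB.pack X bX.
exists _, nat, P, X' => k k1.
rewrite /pmf /= -[LHS]/(fine (mseries m 1 (X @^-1` [set k%:R]))) mseriesE.
rewrite (_ : (\sum_(1 <= _ <oo) _)%E = (f k)%:E)//.
rewrite eseries_recl; last by move=> j j1; rewrite lee_fin mulr_ge0 ?f0.
rewrite (@nneseriesD1 _ _ k.-1)//; last first.
  by move=> j _; rewrite lee_fin mulr_ge0 ?f0.
rewrite prednK// mem_set// mulr1 eseries0 ?adde0// => j _ jk.
rewrite memNset ?mulr0//= => /eqP; rewrite eqr_nat => /eqP jk1.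
by move: jk; rewrite -jk1 eqxx.
Qed.

(** * Ratio test *)

(** For [q] strictly between [r] and 1, eventually [(1 - q) * u k <= u k - u k.+1]. Telescoping from
    [M] on bounds the partial sums by [u M / (1 - q)]. *)
Lemma ratio_test (R : realType) (u v : nat -> R) (r : R) (m : nat) :
  (forall k, (m <= k)%N -> 0 <= u k) -> v k @[k --> \oo] --> r -> r < 1 ->
  (\forall k \near \oo, u k.+1 <= v k * u k) ->
  (\sum_(m <= k <oo) (u k)%:E < +oo)%E.
Proof.
move=> u0 vr r1 uv.
have [q rq q1] : exists2 q, r < q & q < 1.
  by exists ((r + 1) / 2); rewrite ?midf_lt.
have [N _ Nuv] : \forall k \near \oo, (m <= k)%N /\ u k.+1 <= q * u k.
  near=> k; have mk : (m <= k)%N by near: k; exact: nbhs_infty_ge.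
  split => //.
  have /le_trans : u k.+1 <= v k * u k by near: k.
  apply; rewrite ler_wpM2r ?u0//.
  by near: k; exact: cvgr_le rq.
(* Beyond [M] both the sign condition (from [m]) and the ratio bound (from [N]) hold. *)
pose M := (m + N)%N.
have uM k : (m <= k)%N -> (0 <= (u k)%:E)%E by move=> ?; rewrite lee_fin u0.
rewrite (@nneseries_split _ _ m N)// sumEFin lte_add_pinfty ?ltry//.
apply: (@le_lt_trans _ _ (u M / (1 - q))%:E); last exact: ltry.
apply: lime_le.
  apply: is_cvg_nneseries => k Mk _; apply: uM.
  exact: leq_trans (leq_addr _ _) Mk.
near=> K; rewrite sumEFin lee_fin ler_pdivlMr ?subr_gt0//.
have MK : (M <= K)%N by near: K; exact: nbhs_infty_ge.
rewrite mulr_suml.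
have := @telescope_sumr R M K (fun k => - u k) MK.
rewrite opprK => tel.
apply: (@le_trans _ _ (\sum_(M <= k < K) (- u k.+1 - - u k))); last first.
  by rewrite tel addrC gerBl u0// (leq_trans (leq_addr _ _) MK).
apply: ler_sum_nat => k /andP[Mk _].
have [] := Nuv k; first exact: leq_trans (leq_addl _ _) Mk.
by move=> _ uq; rewrite opprK mulrBr mulr1 addrC lerD2r lerN2 mulrC.
Unshelve. all: by end_near. Qed.

Lemma cvg_exprn (R : realType) (u : nat -> R) (a : R) (m : nat) :
  u k @[k --> \oo] --> a -> u k ^+ m @[k --> \oo] --> a ^+ m.
Proof.
move=> ua; exact: (continuous_cvg _ (@exprn_continuous R m a) ua).
Qed.

(** * Tail products and total mass *)

Lemma ratio_pmf_diff (R : realType) (rho : nat -> R) (k : nat) : (1 <= k)%N ->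
  ratio_pmf rho k = \prod_(1 <= t < k) rho t - \prod_(1 <= t < k.+1) rho t.
Proof. by move=> k1; rewrite /ratio_pmf big_nat_recr//= mulrBl mul1r mulrC. Qed.

(** The masses are the successive drops of the tail product, so the partial sums telescope to 1
    minus that product. *)
Lemma is_pmf_ratio (R : realType) (rho : nat -> R) :
  (forall k, (1 <= k)%N -> 0 < rho k <= 1) ->
  \prod_(1 <= t < k) rho t @[k --> \oo] --> (0 : R) ->
  is_pmf (ratio_pmf rho).
Proof.
move=> rho01 S0; split=> [k k1|].
  have /andP[_ rho1] := rho01 k k1.
  rewrite mulr_ge0 ?subr_ge0// big_nat prodr_ge0// => t /andP[t1 _].
  by have /andP[/ltW] := rho01 t t1.
apply: cvg_lim => //.
apply: (@cvg_trans _ ((1 - \prod_(1 <= t < k) rho t)%:E @[k --> \oo])).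
  apply: near_eq_cvg; near=> n.
  have n1 : (1 <= n)%N by near: n; exact: nbhs_infty_ge.
  rewrite sumEFin; congr (_%:E).
  pose S k := - \prod_(1 <= t < k) rho t.
  transitivity (\sum_(1 <= k < n) (S k.+1 - S k)).
    by rewrite telescope_sumr// /S opprK addrC [X in _ = _ + X]big_geq.
  rewrite big_nat [RHS]big_nat; apply: eq_bigr => k /andP[k1 _].
  by rewrite ratio_pmf_diff// opprK addrC.
apply: cvg_EFin; first exact: nearW.
rewrite -[X in _ --> X]subr0; apply: cvgB => //; exact: cvg_cst.
Unshelve. all: by end_near. Qed.

(** * Laws with tail [k^-m] *)

Section power_survival.
Variables (R : realType) (m : nat).

(** In this form the limit 1 follows from that of the harmonic sequence; as a power of [k / (k+1)]
    its products telescope. *)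
Definition power_ratio (k : nat) : R := (1 - k.+1%:R^-1) ^+ m.

Lemma power_ratioE k : power_ratio k = (k%:R / k.+1%:R) ^+ m.
Proof.
rewrite /power_ratio; congr (_ ^+ _).
by rewrite -[in k%:R](addrK 1 k%:R) natr1 mulrBl divff ?pnatr_eq0// mul1r.
Qed.

Lemma power_ratio01 k : (1 <= k)%N -> 0 < power_ratio k <= 1.
Proof.
move=> k1; rewrite power_ratioE exprn_gt0 ?divr_gt0 ?ltr0n//=.
by rewrite exprn_ile1// ler_pdivrMr ?ltr0n// mul1r ler_nat.
Qed.

Lemma cvg_power_ratio : power_ratio k @[k --> \oo] --> (1 : R).
Proof.
have h : (1 - k.+1%:R^-1) @[k --> \oo] --> (1 - 0 : R).
  by apply: cvgB; [exact: cvg_cst|exact: cvg_harmonic].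
by have := cvg_exprn _ _ _ m h; rewrite subr0 expr1n.
Qed.

Lemma prod_power_ratio k : (1 <= k)%N ->
  \prod_(1 <= t < k) power_ratio t = (k%:R ^+ m)^-1.
Proof.
elim: k => // -[_ _|k IH _]; first by rewrite big_geq// expr1n invr1.
rewrite big_nat_recr//= IH// power_ratioE expr_div_n mulrA mulVf ?mul1r//.
Qed.

Lemma ratio_pmf_power k : (1 <= k)%N ->
  ratio_pmf power_ratio k = (k%:R ^+ m)^-1 - (k.+1%:R ^+ m)^-1.
Proof. by move=> k1; rewrite ratio_pmf_diff// !prod_power_ratio. Qed.

Hypothesis m_gt0 : (0 < m)%N.

Lemma is_pmf_power : is_pmf (ratio_pmf power_ratio).
Proof.
apply: is_pmf_ratio; first exact: power_ratio01.
(* The shift matches [harmonic], whose term at [k] is [1 / (k+1)]; a positive [m] makes the limit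
   [0 ^+ m] vanish. *)
rewrite -cvg_shiftS/=; under eq_cvg do rewrite prod_power_ratio// -exprVn.
have := cvg_exprn _ _ _ m (@cvg_harmonic R).
by rewrite expr0n (gtn_eqF m_gt0).
Qed.

Lemma has_ratio_pmf_power : exists (d : measure_display) (T : measurableType d)
    (P : probability T R) (X : {RV P >-> R}), has_ratio_pmf X power_ratio.
Proof.
have [d [T [P [X X_pmf]]]] := pmf_realization _ _ is_pmf_power.
by exists d, T, P, X; split=> //; [exact: power_ratio01|exact: is_pmf_power].
Qed.

End power_survival.

(** * Moments of the power laws *)

Lemma inv_natM_succ (R : realType) (k : nat) : (1 <= k)%N ->
  (k%:R * k.+1%:R)^-1 = k%:R^-1 - k.+1%:R^-1 :> R.
Proof.
move=> k1; have k0 : k%:R != 0 :> R by rewrite pnatr_eq0 -lt0n.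
have k0' : k%:R + 1 != 0 :> R by rewrite natr1 pnatr_eq0.
by rewrite -natr1; field; rewrite k0 k0'.
Qed.

Lemma sum_power_moment_lty (R : realType) (n : nat) :
  (\sum_(1 <= k <oo) (k%:R ^+ n * ratio_pmf (power_ratio R n.+2) k)%:E
   < +oo)%E.
Proof.
have [f0 f1] := is_pmf_power R 1 isT; have [g0 _] := is_pmf_power R n.+2 isT.
(* [k^n (k^-(n+2) - (k+1)^-(n+2)) <= k^-2 <= 2 / (k (k+1))], and the last term
   is twice the mass function of exponent 1, whose total mass is known. *)
apply: (@le_lt_trans _ _ (2%:E *
    \sum_(1 <= k <oo) (ratio_pmf (power_ratio R 1) k)%:E)%E); last first.
  by rewrite f1 mule1 ltry.
rewrite !eseries_recl; last 2 first.
- by move=> k k1; rewrite lee_fin mulr_ge0 ?exprn_ge0 ?g0.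
- by move=> k /f0; rewrite lee_fin.
rewrite -nneseriesZl; last by move=> k _; rewrite lee_fin f0.
apply: lee_nneseries => k; first by rewrite lee_fin mulr_ge0 ?exprn_ge0 ?g0.
move=> _; rewrite -EFinM lee_fin !ratio_pmf_power// !expr1 -inv_natM_succ//.
have k0 : 0 < k.+1%:R :> R by rewrite ltr0n.
apply: (@le_trans _ _ (k.+1%:R ^+ 2)^-1).
  rewrite -[leRHS]mulr1 ler_pdivlMl ?exprn_gt0// mulrA -exprD mulrBr.
  by rewrite divff ?expf_neq0 ?gt_eqF// gerBl mulr_ge0 ?invr_ge0 ?exprn_ge0.
(* With the index shifted by one, this reduces to [k + 2 <= 2 (k + 1)]. *)
rewrite ler_pdivlMr ?mulr_gt0 ?ltr0n// ler_pdivrMl ?exprn_gt0// expr2.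
by rewrite -mulrA ler_pM2l// -natrM ler_nat muln2 doubleS !ltnS -addnn leq_addr.
Qed.

(** The terms are [k^n / (k (k+1))], at least [1 / (k+1)] since [n >= 1], so a finite sum would make
    the harmonic series converge. *)
Lemma sum_power1_moment (R : realType) (n : nat) : (1 <= n)%N ->
  (\sum_(1 <= k <oo) (k%:R ^+ n * ratio_pmf (power_ratio R 1) k)%:E
   = +oo)%E.
Proof.
move=> n1; have [f0 _] := is_pmf_power R 1 isT.
apply/eqP; rewrite eq_le leey/= leNgt; apply/negP => sum_lty.
apply: (@dvg_harmonic R); apply: nnseries_is_cvg => [k|].
  exact: harmonic_ge0.
(* The term 1 at index 0 is split off, as the comparison starts at [k = 1]. *)
rewrite nneseries_recl//; last by move=> k _; rewrite lee_fin; exact: harmonic_ge0.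
apply: lte_add_pinfty; first exact: ltry.
apply: le_lt_trans sum_lty; rewrite !eseries_recl; last 2 first.
- by move=> k k1; rewrite lee_fin mulr_ge0 ?exprn_ge0 ?f0.
- by move=> k _; rewrite lee_fin; exact: harmonic_ge0.
apply: lee_nneseries => [k _ _|k _]; first by rewrite lee_fin; exact: harmonic_ge0.
rewrite lee_fin ratio_pmf_power// !expr1 -inv_natM_succ// invfM mulrA.
rewrite /harmonic ler_peMl ?invr_ge0// ler_pdivlMr ?ltr0n// mul1r.
by rewrite -[leLHS]expr1 ler_weXn2l ?ler1n.
Qed.

(** * Limits of the ratios and the case [r < 1] *)

Lemma cvg_ratio_bounds (R : realType) (rho : nat -> R) (r : R) :
  (forall k, (1 <= k)%N -> 0 < rho k <= 1) -> rho k @[k --> \oo] --> r ->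
  0 <= r <= 1.
Proof.
move=> rho01 rho_r; apply/andP; split.
- apply: cvgr_to_ge rho_r _; near=> k.
  have /rho01/andP[/ltW] // : (1 <= k)%N by near: k; exact: nbhs_infty_ge.
- apply: cvgr_to_le rho_r _; near=> k.
  have /rho01/andP[] // : (1 <= k)%N by near: k; exact: nbhs_infty_ge.
Unshelve. all: by end_near. Qed.

Lemma sum_moment_lty (R : realType) (rho : nat -> R) (r : R) (n : nat) :
  (forall k, (1 <= k)%N -> 0 < rho k <= 1) -> rho k @[k --> \oo] --> r ->
  r < 1 ->
  (\sum_(1 <= k <oo) (k%:R ^+ n * ratio_pmf rho k)%:E < +oo)%E.
Proof.
move=> rho01 rho_r r1; pose S k := \prod_(1 <= t < k) rho t.
have S_gt0 k : 0 < S k.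
  rewrite /S big_nat prodr_gt0// => t /andP[t1 _].
  by have /andP[] := rho01 t t1.
have S_le k : (1 <= k)%N -> 0 <= ratio_pmf rho k <= S k.
  move=> k1; have /andP[rho0 rho1] := rho01 k k1.
  rewrite /ratio_pmf -/(S k) mulr_ge0 ?subr_ge0 ?(ltW (S_gt0 k))//=.
  by rewrite ler_piMl ?(ltW (S_gt0 k))// gerBl ltW.
pose u k := k%:R ^+ n * S k.
(* The inverse of [power_ratio] is the factor [((k+1)/k)^n]; for [k >= 1] the recursion
   [u k.+1 = v k * u k] is exact. *)
pose v k := rho k * (power_ratio R n k)^-1.
have u_lty : (\sum_(1 <= k <oo) (u k)%:E < +oo)%E.
  apply: (@ratio_test _ u v r) => //.
  - by move=> k _; rewrite mulr_ge0 ?exprn_ge0// ltW.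
  - have : v k @[k --> \oo] --> r * 1^-1.
      by apply: cvgM => //; apply: cvgV (cvg_power_ratio R n); exact: oner_neq0.
    by rewrite invr1 mulr1.
  - near=> k; have k1 : (1 <= k)%N by near: k; exact: nbhs_infty_ge.
    have k0 : k%:R != 0 :> R by rewrite pnatr_eq0 -lt0n.
    rewrite /u /v /S big_nat_recr//= power_ratioE expr_div_n invfM invrK.
    rewrite le_eqVlt; apply/orP; left; apply/eqP.
    by field; rewrite expf_neq0.
apply: le_lt_trans u_lty; rewrite !eseries_recl.
- apply: lee_nneseries => k _; have /andP[f0 fS] := S_le k.+1 isT.
    by rewrite lee_fin mulr_ge0 ?exprn_ge0.
  by rewrite lee_fin ler_wpM2l ?exprn_ge0.
- by move=> k _; rewrite lee_fin mulr_ge0 ?exprn_ge0// ltW.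
- by move=> k /S_le/andP[f0 _]; rewrite lee_fin mulr_ge0 ?exprn_ge0.
Unshelve. all: by end_near. Qed.

(** That the limit 1 is inconclusive is made precise by two laws for each order, one on each
    side. *)
Theorem proposition2p4 (R : realType) :
  (forall (d : measure_display) (T : measurableType d) (P : probability T R)
      (X : {RV P >-> R}) (rho : nat -> R) (r : R),
    has_ratio_pmf X rho -> rho k @[k --> \oo] --> r ->
    0 <= r <= 1 /\
    (r < 1 -> forall n : nat, (1 <= n)%N -> moment_exists X n))
  /\
  (forall n : nat, (1 <= n)%N ->
    (exists (d : measure_display) (T : measurableType d) (P : probability T R)
        (X : {RV P >-> R}) (rho : nat -> R),
      [/\ has_ratio_pmf X rho, rho k @[k --> \oo] --> (1 : R)
        & moment_exists X n]) /\
    (exists (d : measure_display) (T : measurableType d) (P : probability T R)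
        (X : {RV P >-> R}) (rho : nat -> R),
      [/\ has_ratio_pmf X rho, rho k @[k --> \oo] --> (1 : R)
        & ~ moment_exists X n])).
Proof.
split=> [d T P X rho r [rho01 f_pmf X_pmf] rho_r|n n1].
  split=> [|r1 n n1]; first exact: cvg_ratio_bounds rho01 rho_r.
  rewrite /moment_exists (expectation_exprn_pmf _ _ _ _ _ _ f_pmf X_pmf).
  exact: sum_moment_lty rho01 rho_r r1.
split.
- have [d [T [P [X [rho01 f_pmf X_pmf]]]]] := has_ratio_pmf_power R n.+2 isT.
  exists d, T, P, X, (power_ratio R n.+2); split => //.
    exact: cvg_power_ratio.
  rewrite /moment_exists (expectation_exprn_pmf _ _ _ _ _ _ f_pmf X_pmf).
  exact: sum_power_moment_lty.
- have [d [T [P [X [rho01 f_pmf X_pmf]]]]] := has_ratio_pmf_power R 1 isT.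
  exists d, T, P, X, (power_ratio R 1); split => //.
    exact: cvg_power_ratio.
  rewrite /moment_exists (expectation_exprn_pmf _ _ _ _ _ _ f_pmf X_pmf).
  by rewrite sum_power1_moment.
Qed.
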